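(* Let $k,n,p\ge1$, let $\mathcal{A}\in\mathbb{C}^{n\times\dots\times n\times p}$ be an order $2k+1$ $t$-conjugate partially symmetric hypermatrix, and let $\mathcal{X}$ be an $n\times p$ indeterminate complex tubal vector with $\widehat{\mathcal{X}}_{(\ell)}=x^\ell$ for $\ell\in[p]$. After applying the FFT along the tubal modes of $\mathcal{A}$, $\mathcal{X}$ and $J(\mathcal{X})$, the degree $k$ $t$-Hermitian form $h_{\mathcal{A}}(\mathcal{X})$ decomposes into a collection of classical degree $k$ Hermitian forms; that is, $$\widehat{h_{\mathcal{A}}(\mathcal{X})}[\ell]=\widehat{\mathcal{A}}_{(\ell)}*\big(\underbrace{\overline{x^\ell},\dots,\overline{x^\ell}}_{k},\underbrace{x^\ell,\dots,x^\ell}_{k}\big)\qquad\text{for all }\ell\in[p],$$ where $\widehat{h_{\mathcal{A}}(\mathcal{X})}:=\mathrm{fft}\big(h_{\mathcal{A}}(\mathcal{X})\big)$.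
   Context: Notation: $[m]=\{1,\dots,m\}$. For a tube $a$ of length $p$, $\widehat a=\mathrm{fft}(a)$ is $\widehat a[\ell]=\sum_{m=1}^p e^{-2\pi i(\ell-1)(m-1)/p}a[m]$; for arrays whose last mode (tubal mode) has length $p$, the hat means applying $\mathrm{fft}$ along that mode, and $(\ell)$ means fixing the last index to $\ell$. Circular convolution: $(a\circledast b)[\ell]=\sum_{m=1}^p a[m]\,b[((\ell-m)\bmod p)+1]$. Fourier conjugation of a tube: $J(a)[\ell+1]=\overline{a[((-\ell)\bmod p)+1]}$, $\ell=0,\dots,p-1$; it acts tube by tube on tubal vectors. An $n\times p$ indeterminate complex tubal vector $\mathcal{X}$ is one for which $\widehat{\mathcal{X}}_{(\ell)}=x^\ell=[x_1^\ell,\dots,x_n^\ell]^T$ is a vector of complex variables for each $\ell\in[p]$; conjugation sends a variable to its formal conjugate. Multilinear matrix multiplication: for an order $N$ hypermatrix $\mathcal{B}\in\mathbb{C}^{n\times\dots\times n}$ and vectors $y^1,\dots,y^N$ of length $n$, $\mathcal{B}*(y^1,\dots,y^N)=\sum_{i_1,\dots,i_N=1}^n\mathcal{B}[i_1,\dots,i_N]y^1_{i_1}\cdots y^N_{i_N}$. $t$-multilinear hypermatrix product: $\mathcal{A}*_t(\mathcal{X}^1,\dots,\mathcal{X}^N)=\sum_{i_1,\dots,i_N=1}^n\mathcal{A}[i_1,\dots,i_N,:]\circledast\mathcal{X}^1[i_1,:]\circledast\cdots\circledast\mathcal{X}^N[i_N,:]$. An order $2k$ hypermatrix $\mathcal{B}=[b_{i_1\dots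 i_kj_1\dots j_k}]\in\mathbb{C}^{n\times\dots\times n}$ is conjugate partially symmetric if $\overline{b_{j_{\sigma(1)}\dots j_{\sigma(k)}i_{\tau(1)}\dots i_{\tau(k)}}}=b_{i_1\dots i_kj_1\dots j_k}$ for all indices and all $\sigma,\tau\in S_k$; a classical degree $k$ Hermitian form in variables $x$ is $\mathcal{B}*(\overline x,\dots,\overline x,x,\dots,x)$ ($k$ copies of each) for such a $\mathcal{B}$. An order $2k+1$ hypermatrix $\mathcal{A}\in\mathbb{C}^{n\times\dots\times n\times p}$ is $t$-conjugate partially symmetric if each $\widehat{\mathcal{A}}_{(\ell)}$, $\ell\in[p]$, is conjugate partially symmetric, and its degree $k$ $t$-Hermitian form is $h_{\mathcal{A}}(\mathcal{X})=\mathcal{A}*_t(J(\mathcal{X}),\dots,J(\mathcal{X}),\mathcal{X},\dots,\mathcal{X})$ ($k$ copies of each). *)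

(* Defs.v *)
(* All indices are 0-based: l : 'I_p stands for the element l + 1 of [p]. *)
From HB Require Import structures.
From mathcomp Require Import all_boot all_order all_algebra all_fingroup.
From mathcomp Require Import complex mpoly.
From mathcomp Require Import reals trigo.

Set Implicit Arguments.
Unset Strict Implicit.
Unset Printing Implicit Defensive.

Import Order.TTheory GRing.Theory Num.Theory.

Local Open Scope ring_scope.
Local Open Scope complex_scope.

Definition expi (R : realType) (t : R) : R[i] := cos t +i* sin t.

(* An m x p tubal vector is a matrix whose rows are its tubes; a tube is the
   case m = 1.  Entries live in a C-algebra, so that the same fft serves
   complex arrays (in R[i]^o) and arrays of polynomials. *)
Definition fft (R : realType) (P : comAlgType R[i]) (m p : nat)
    (a : 'M[P]_(m, p)) : 'M[P]_(m, p) :=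
  \matrix_(i, l) \sum_(s < p)
     expi (- (2 * pi * l%:R * s%:R / p%:R)) *: a i s.

(* l - m modulo p *)
Definition ord_sub (p : nat) (l m : 'I_p) : 'I_p :=
  Ordinal (ltn_pmod (l + (p - m))%N (leq_ltn_trans (leq0n l) (ltn_ord l))).

(* - l modulo p *)
Definition ord_neg (p : nat) (l : 'I_p) : 'I_p :=
  Ordinal (ltn_pmod (p - l)%N (leq_ltn_trans (leq0n l) (ltn_ord l))).

Definition cconv (P : pzRingType) (p : nat) (a b : 'rV[P]_p) : 'rV[P]_p :=
  \row_l \sum_(m < p) a 0 m * b 0 (ord_sub l m).

Definition fourier_conj (P : Type) (conj : P -> P) (n p : nat)
    (X : 'M[P]_(n, p)) : 'M[P]_(n, p) :=
  \matrix_(i, l) conj (X i (ord_neg l)).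

Definition hypermatrix (N n : nat) (T : Type) := {ffun N.-tuple 'I_n -> T}.

(* A hypermatrix of order N + 1 whose last mode has length p. *)
Definition tubal_hypermatrix (R : realType) (N n p : nat) :=
  hypermatrix N n 'rV[R[i]]_p.

Definition fft_slice (R : realType) (N n p : nat)
    (A : tubal_hypermatrix R N n p) (l : 'I_p) : hypermatrix N n R[i] :=
  [ffun i => fft (A i : 'rV[R[i]^o]_p) 0 l].

Definition multilin_mul (R : realType) (P : comAlgType R[i]) (N n : nat)
    (B : hypermatrix N n R[i]) (y : N.-tuple 'cV[P]_n) : P :=
  \sum_(i : N.-tuple 'I_n)
     B i *: \prod_(j < N) (tnth y j) (tnth i j) 0.

(* The tubes of A are viewed in P through the structure map c |-> c%:A. *)
Definition t_multilin_mul (R : realType) (P : comAlgType R[i]) (N n p : nat)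
    (A : tubal_hypermatrix R N n p) (X : N.-tuple 'M[P]_(n, p)) : 'rV[P]_p :=
  \sum_(i : N.-tuple 'I_n)
     foldl (@cconv P p) (map_mx (fun c : R[i] => c%:A) (A i))
       [seq row (tnth i j) (tnth X j) | j <- enum 'I_N].

Definition perm_index (k n : nat) (i : k.-tuple 'I_n) (s : 'S_k)
    : k.-tuple 'I_n :=
  [tuple tnth i (s m) | m < k].

Definition conj_partially_symmetric (R : realType) (k n : nat)
    (B : hypermatrix (k + k) n R[i]) : Prop :=
  forall (i j : k.-tuple 'I_n) (s t : 'S_k),
    (B [tuple of perm_index j s ++ perm_index i t])^* = B [tuple of i ++ j].

Definition t_conj_partially_symmetric (R : realType) (k n p : nat)
    (A : tubal_hypermatrix R (k + k) n p) : Prop :=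
  forall l : 'I_p, conj_partially_symmetric (fft_slice A l).

Definition hermitian_mul (R : realType) (P : comAlgType R[i])
    (conj : P -> P) (k n : nat)
    (B : hypermatrix (k + k) n R[i]) (x : 'cV[P]_n) : P :=
  multilin_mul B [tuple of nseq k (map_mx conj x) ++ nseq k x].

Definition is_hermitian_form (R : realType) (P : comAlgType R[i])
    (conj : P -> P) (k n : nat) (x : 'cV[P]_n) (h : P) : Prop :=
  exists2 B : hypermatrix (k + k) n R[i],
    conj_partially_symmetric B & h = hermitian_mul conj B x.

Definition t_hermitian_form (R : realType) (P : comAlgType R[i])
    (conj : P -> P) (k n p : nat)
    (A : tubal_hypermatrix R (k + k) n p) (X : 'M[P]_(n, p)) : 'rV[P]_p :=
  t_multilin_mul A [tuple of nseq k (fourier_conj conj X) ++ nseq k X].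

(* (false, i, l) indexes the variable x_i^l and (true, i, l) its formal
   conjugate. *)
Definition cvar (n p : nat) := (bool * 'I_n * 'I_p)%type.

Definition cvar_conj (n p : nat) (v : cvar n p) : cvar n p :=
  (~~ v.1.1, v.1.2, v.2).

Notation cpoly R n p := {mpoly R[i][#|{: cvar n p}|]}.

(* Formal conjugation: conjugates the coefficients and exchanges each variable with its formal
   conjugate. *)
Definition cpoly_conj (R : realType) (n p : nat) (q : cpoly R n p)
    : cpoly R n p :=
  mmap (fun c : R[i] => (c^*)%:MP)
       (fun u => 'X_(enum_rank (cvar_conj (enum_val u)))) q.

Definition var_vec (R : realType) (n p : nat) (l : 'I_p)
    : 'cV[cpoly R n p]_n :=
  \col_i 'X_(enum_rank ((false, i, l) : cvar n p)).

Definition indeterminate (R : realType) (n p : nat)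
    (X : 'M[cpoly R n p]_(n, p)) : Prop :=
  forall l : 'I_p, col l (fft X) = var_vec R n l.

(* Main.v *)
Require Import Defs.
From HB Require Import structures.
From mathcomp Require Import all_boot all_order all_algebra all_fingroup.
From mathcomp Require Import complex mpoly.
From mathcomp Require Import reals trigo.

Set Implicit Arguments.
Unset Strict Implicit.
Unset Printing Implicit Defensive.

Import Order.TTheory GRing.Theory Num.Theory.

Local Open Scope ring_scope.

(** The discrete Fourier transform turns circular convolution into the
    entrywise product, because l |-> expi (- 2 pi l s / p) is a character of
    Z/p, and it turns Fourier conjugation into entrywise conjugation, because
    the reflection m |-> - m compensates the conjugation of that character.
    Hence the l-th Fourier coefficient of each summand of the t-product is the
    product of the l-th Fourier coefficients of its factors. *)

Lemma expiD (R : realType) (s t : R) : expi (s + t) = expi s * expi t.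
Proof. by rewrite /expi cosD sinD [sin s * _ + _]addrC. Qed.

Lemma expi_conj (R : realType) (t : R) : ((expi t)^*)%C = expi (- t).
Proof. by rewrite /expi cosN sinN. Qed.

Lemma expiMn (R : realType) (t : R) (m : nat) : expi (t *+ m) = expi t ^+ m.
Proof.
elim: m => [|m IHm]; first by rewrite mulr0n /expi cos0 sin0.
by rewrite mulrS exprS expiD IHm.
Qed.

(** All coefficients of [fft] are powers of this root, so phases become natural exponents. *)
Definition fft_root (R : realType) (p : nat) : R[i] :=
  expi (- (2 * pi / p%:R)).

Lemma fft_rootX (R : realType) (p l s : nat) :
  expi (- (2 * pi * l%:R * s%:R / p%:R)) = fft_root R p ^+ (l * s).
Proof.
rewrite -expiMn mulNrn -[_ / _ *+ _]mulr_natr natrM !mulrA.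
by rewrite -!(mulrAC _ p%:R^-1).
Qed.

Lemma fft_root_unity (R : realType) (p : nat) :
  (0 < p)%N -> fft_root R p ^+ p = 1.
Proof.
move=> p_gt0; rewrite -expiMn mulNrn -[_ / _ *+ _]mulr_natr.
rewrite divfK ?pnatr_eq0 -?lt0n // -expi_conj mulr_natl /expi.
by rewrite cos2pi sin2pi /= oppr0.
Qed.

(** Clears the remainders that [ord_sub] and [ord_neg] put into exponents. *)
Lemma fft_rootX_mod (R : realType) (p l s : nat) :
  (0 < p)%N -> fft_root R p ^+ (l * (s %% p)) = fft_root R p ^+ (l * s).
Proof.
move=> p_gt0; rewrite {2}(divn_eq s p) mulnDr exprD mulnA [(_ * p)%N]mulnC.
by rewrite [X in X * _]exprM fft_root_unity // expr1n mul1r.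
Qed.

(** Conjugation inverts a number of modulus one, and the exponents [l * s] and [l * (p - s)] add up
    to the multiple [l * p] of the period. *)
Lemma fft_rootX_conj (R : realType) (p l s : nat) :
  (0 < p)%N -> (s <= p)%N ->
  ((fft_root R p ^+ (l * s))^*)%C = fft_root R p ^+ (l * (p - s)).
Proof.
move=> p_gt0 le_sp; rewrite -expiMn expi_conj.
set a := (- _)%R; have: expi a * fft_root R p ^+ (l * s) = 1.
  by rewrite -expiMn -expiD addNr /expi cos0 sin0.
move=> inv_a; rewrite -[RHS]mul1r -inv_a -mulrA -exprD -mulnDr subnKC //.
by rewrite mulnC exprM fft_root_unity // expr1n mulr1.
Qed.

Lemma fftE (R : realType) (P : comAlgType R[i]) (m p : nat) (a : 'M[P]_(m, p))
    (i : 'I_m) (l : 'I_p) :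
  fft a i l = \sum_(s < p) fft_root R p ^+ (l * s) *: a i s.
Proof. by rewrite mxE; apply: eq_bigr => s _; rewrite fft_rootX. Qed.

Lemma fft_sum (R : realType) (P : comAlgType R[i]) (m p : nat) (I : finType)
    (a : I -> 'M[P]_(m, p)) : fft (\sum_i a i) = \sum_i fft (a i).
Proof.
apply/matrixP=> r l; rewrite summxE fftE.
under eq_bigr => s _ do rewrite summxE scaler_sumr.
by rewrite exchange_big; apply: eq_bigr => i _; rewrite fftE.
Qed.

Lemma fft_row (R : realType) (P : comAlgType R[i]) (m p : nat)
    (a : 'M[P]_(m, p)) (i : 'I_m) (l : 'I_p) :
  fft (row i a) 0 l = fft a i l.
Proof. by rewrite !fftE; apply: eq_bigr => s _; rewrite mxE. Qed.

(** Reconciles [t_multilin_mul], which embeds the tubes of the hypermatrix in [P], with [fft_slice],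
    which transforms them over the complex numbers. *)
Lemma fft_in_alg (R : realType) (P : comAlgType R[i]) (m p : nat)
    (a : 'M[R[i]]_(m, p)) (i : 'I_m) (l : 'I_p) :
  fft (map_mx (fun c : R[i] => c%:A : P) a) i l
  = (fft (a : 'M[R[i]^o]_(m, p)) i l)%:A.
Proof.
rewrite !fftE scaler_suml; apply: eq_bigr => s _.
by rewrite mxE scalerA.
Qed.

Lemma ord_sub_inj (p : nat) (m : 'I_p) : injective (fun s => ord_sub s m).
Proof.
move=> s t /(congr1 val) /= /eqP; rewrite eqn_modDr !modn_small //.
by move/eqP/val_inj.
Qed.

Lemma ord_negK (p : nat) : involutive (@ord_neg p).
Proof.
(* At [s = 0] the modulus sends [p - 0] back to 0; for [s > 0] the value [p - s] is already
   reduced. *)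
move=> s; apply: val_inj => /=; have [s0|s_gt0] := posnP s.
  by rewrite s0 subn0 modnn subn0 modnn.
rewrite (@modn_small (p - s)) ?subKn ?modn_small //; first exact: ltnW.
by rewrite -subn_gt0 subKn // ltnW.
Qed.

Lemma fft_cconv (R : realType) (P : comAlgType R[i]) (p : nat)
    (a b : 'rV[P]_p) (l : 'I_p) :
  fft (cconv a b) 0 l = fft a 0 l * fft b 0 l.
Proof.
rewrite !fftE mulr_suml.
under eq_bigr => s _ do rewrite mxE scaler_sumr.
rewrite exchange_big; apply: eq_bigr => m _.
(* For fixed [m], the shift by [m] permutes the indices, so the two sums match term by term. *)
rewrite [in RHS](reindex_inj (@ord_sub_inj p m)) mulr_sumr.
have p_gt0 : (0 < p)%N := leq_ltn_trans (leq0n l) (ltn_ord l).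
apply: eq_bigr => s _; rewrite -scalerAl -scalerAr scalerA; congr (_ *: _).
(* The exponents of the two factors add up to [l * (s + p)], which agrees with [l * s] modulo
   [p]. *)
rewrite /= fft_rootX_mod // -exprD -mulnDr addnCA subnKC; last exact: ltnW.
by rewrite -[RHS]fft_rootX_mod // modnDr fft_rootX_mod.
Qed.

Lemma fft_foldl_cconv (R : realType) (P : comAlgType R[i]) (p : nat)
    (bs : seq 'rV[P]_p) (a : 'rV[P]_p) (l : 'I_p) :
  fft (foldl (@cconv P p) a bs) 0 l = fft a 0 l * \prod_(b <- bs) fft b 0 l.
Proof.
elim: bs a => [|b bs IHbs] a /=; first by rewrite big_nil mulr1.
by rewrite IHbs big_cons fft_cconv mulrA.
Qed.

(** By additivity of [fft] it suffices to treat one summand, a convolution of [N + 1] tubes whose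
    first factor becomes the scalar coefficient. *)
Lemma fft_t_multilin_mul (R : realType) (P : comAlgType R[i]) (N n p : nat)
    (A : tubal_hypermatrix R N n p) (X : N.-tuple 'M[P]_(n, p)) (l : 'I_p) :
  fft (t_multilin_mul A X) 0 l
  = multilin_mul (fft_slice A l) [tuple of map (fun Y => col l (fft Y)) X].
Proof.
rewrite fft_sum summxE; apply: eq_bigr => i _.
rewrite fft_foldl_cconv fft_in_alg big_map big_enum ffunE /= mulr_algl.
by congr (_ *: _); apply: eq_bigr => j _; rewrite tnth_map fft_row [RHS]mxE.
Qed.

Lemma fft_fourier_conj (R : realType) (P : comAlgType R[i]) (conj : P -> P)
    (conjD : {morph conj : x y / x + y}) (conj0 : conj 0 = 0)
    (conjZ : forall (c : R[i]) x, conj (c *: x) = (c^*)%C *: conj x)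
    (m p : nat) (a : 'M[P]_(m, p)) :
  fft (fourier_conj conj a) = map_mx conj (fft a).
Proof.
apply/matrixP=> i l; rewrite [RHS]mxE !fftE (big_morph conj conjD conj0).
have p_gt0 : (0 < p)%N := leq_ltn_trans (leq0n l) (ltn_ord l).
rewrite [in RHS](reindex_inj (inv_inj (@ord_negK p))).
apply: eq_bigr => s _; rewrite mxE conjZ; congr (_ *: _).
(* Reflection and conjugation each replace [s] by [p - s] in the exponent, so together they
   cancel. *)
rewrite /= fft_rootX_mod // fft_rootX_conj ?leq_subr // subKn //.
exact: ltnW.
Qed.

Section CpolyConj.
Variables (R : realType) (n p : nat).
Local Notation conj := (@cpoly_conj R n p).

(** The coefficient map of [cpoly_conj], packaged as a ring morphism so that the general facts on
    [mmap] apply. *)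
Let conj_coef : {rmorphism R[i] -> cpoly R n p} :=
  @mpolyC #|{: cvar n p}| R[i] \o conjc.

Lemma cpoly_conjD : {morph conj : q r / q + r}.
Proof. exact: (@mmapD _ _ _ _ conj_coef). Qed.

Lemma cpoly_conj0 : conj 0 = 0.
Proof. exact: (@mmap0 _ _ _ _ conj_coef). Qed.

Lemma cpoly_conjZ (c : R[i]) (q : cpoly R n p) :
  conj (c *: q) = (c^*)%C *: conj q.
Proof. by rewrite -[RHS]mul_mpolyC; exact: (@mmapZ _ _ _ _ conj_coef). Qed.

End CpolyConj.

Theorem fact3p17 (R : realType) (k n p : nat)
    (hk : (0 < k)%N) (hn : (0 < n)%N) (hp : (0 < p)%N)
    (A : tubal_hypermatrix R (k + k) n p)
    (hA : t_conj_partially_symmetric A)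
    (X : 'M[cpoly R n p]_(n, p))
    (hX : indeterminate X) :
  forall l : 'I_p,
    is_hermitian_form (@cpoly_conj R n p) k (var_vec R n l)
      (fft (t_hermitian_form (@cpoly_conj R n p) A X) 0 l)
    /\
    fft (t_hermitian_form (@cpoly_conj R n p) A X) 0 l
    = multilin_mul (fft_slice A l)
        [tuple of nseq k (map_mx (@cpoly_conj R n p) (var_vec R n l))
                  ++ nseq k (var_vec R n l)].
Proof.
move=> l; set h := fft _ 0 l; set rhs := multilin_mul _ _.
(* The slice itself is the Hermitian coefficient array, its symmetry being [hA] at [l]. *)
suff h_rhs : h = rhs by split=> //; exists (fft_slice A l).
rewrite /h fft_t_multilin_mul; congr multilin_mul; apply: val_inj.
rewrite /= map_cat !map_nseq hX; congr (nseq _ _ ++ _).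
(* What remains is the conjugate-linearity of formal conjugation. *)
rewrite fft_fourier_conj -?hX ?map_col //.
- exact: cpoly_conjD.
- exact: cpoly_conj0.
- exact: cpoly_conjZ.
Qed.
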